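(* Let $n$ be a positive integer with $4\mid n$, let $d=n/2$, and for $1\le i\le d$ let $$c_i=\begin{cases} i, & i \text{ odd}\\ d-i, & i\text{ even.}\end{cases}$$ Then the circlet inequality $$\sum_{i=1}^d c_i t_i\ \ge\ n-2$$ is facet-defining for $STSP(n)$.
   Context: $K_n=([n],E)$ is the complete undirected graph on the vertex set $[n]=\{1,\dots,n\}$. For a Hamiltonian cycle $H$ on $K_n$, $\chi_H\in\{0,1\}^{E}$ is its edge-incidence vector. The symmetric Traveling Salesman Problem polytope is $STSP(n)=\mathrm{conv}\{\chi_H: H\text{ is a Hamiltonian cycle on }K_n\}\subset\mathbb{R}^{E}$. The length of an edge $\{i,j\}$ is $\ell_{i,j}=\min\{|i-j|,\,n-|i-j|\}$. For $x\in\mathbb{R}^{E}$ and $1\le i\le d$, $t_i=\sum_{\{s,t\}\in E:\ \ell_{s,t}=i}x_{s,t}$, so the circlet inequality is a linear inequality in $x$. A linear inequality $ax\ge a_0$ is valid for $STSP(n)$ if every $x\in STSP(n)$ satisfies it; it is facet-defining for $STSP(n)$ if it is valid and the set $S=\{x\in STSP(n): ax=a_0\}$ satisfies $\dim(S)=\dim(STSP(n))-1$ (dimension meaning dimension of the affine hull). *)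

(* Defs.v *)
From HB Require Import structures.
From mathcomp Require Import all_boot all_order all_algebra.
From mathcomp Require Import boolp classical_sets reals.

Set Implicit Arguments.
Unset Strict Implicit.
Unset Printing Implicit Defensive.

Import Order.TTheory GRing.Theory Num.Theory.
Local Open Scope classical_set_scope.
Local Open Scope ring_scope.

Section Polyhedra.
Variables (R : realType) (V : vectType R).
Implicit Types (A P : set V) (f : {scalar V}) (k : int).

Definition convex_hull A : set V :=
  [set x | exists (m : nat) (w : 'I_m -> R) (p : 'I_m -> V),
    [/\ forall i, 0 <= w i, \sum_i w i = 1, forall i, A (p i)
      & x = \sum_i w i *: p i]].

Definition affine_hull A : set V :=
  [set x | exists (m : nat) (w : 'I_m -> R) (p : 'I_m -> V),
    [/\ \sum_i w i = 1, forall i, A (p i) & x = \sum_i w i *: p i]].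

(* A nonempty affine subspace is x0 + U for a unique linear subspace U, and its
   dimension is \dim U; the empty set has dimension -1. *)
Definition has_affine_dim A k : Prop :=
  (A = set0 /\ k = -1) \/
  exists (x0 : V) (U : {vspace V}),
    affine_hull A = [set x0 + u | u in [set u : V | u \in U]]
    /\ k = (\dim U)%:Z.

Definition valid_ineq P f (a0 : R) : Prop := forall x, P x -> a0 <= f x.

Definition facet_defining P f (a0 : R) : Prop :=
  valid_ineq P f a0 /\
  exists k : int, has_affine_dim P k
    /\ has_affine_dim [set x | P x /\ f x = a0] (k - 1).

End Polyhedra.

(* The vertex set {1, ..., n} is shifted to 'I_n = {0, ..., n-1}, which leaves
   all differences |i - j| unchanged. *)
Definition edge (n : nat) := {A : {set 'I_n} | #|A| == 2%N}.

(* R^E; the codomain is R^o so that the function type is a vector space. *)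
Notation edge_space R n := {ffun edge n -> R^o}.

(* The sequence s lists all the vertices in the cyclic order of the cycle. The
   condition on size s excludes degenerate closed walks along a single edge. *)
Definition hamiltonian_cycle (n : nat) (H : {set edge n}) : Prop :=
  exists s : seq 'I_n,
    [/\ (2 < size s)%N, ucycle (fun u v => u != v) s, forall v, v \in s
      & H = [set e : edge n | [exists v, val e == [set v; next s v]%SET]]%SET].

Definition incidence (R : realType) (n : nat) (H : {set edge n}) :
  edge_space R n := [ffun e => (e \in H)%:R].

Definition STSP (R : realType) (n : nat) : set (edge_space R n) :=
  convex_hull [set incidence R H | H in @hamiltonian_cycle n].

Definition pair_length (n : nat) (i j : 'I_n) : nat :=
  let m := `|(i : nat)%:Z - (j : nat)%:Z|%N in minn m (n - m).

Definition edge_has_length (n : nat) (i : nat) (e : edge n) : bool :=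
  [exists u, exists v, (val e == [set u; v]%SET) && (pair_length u v == i)].

Definition edge_length_sum (R : realType) (n : nat) (i : nat)
  (x : edge_space R n) : R := \sum_(e | edge_has_length i e) x e.

Definition circlet_coeff (d i : nat) : nat := if odd i then i else (d - i)%N.

Definition circlet (R : realType) (n : nat) (x : edge_space R n) : R :=
  let d := n./2 in
  \sum_(1 <= i < d.+1) (circlet_coeff d i)%:R * edge_length_sum i x.

Fact edge_length_sum_is_scalar (R : realType) (n i : nat) :
  scalar (@edge_length_sum R n i).
Proof.
move=> a x y; rewrite /edge_length_sum mulr_sumr -big_split /=.
by apply: eq_bigr => e _; rewrite !ffunE.
Qed.

Fact circlet_is_scalar (R : realType) (n : nat) : scalar (@circlet R n).
Proof.
move=> a x y; rewrite /circlet mulr_sumr -big_split /=.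
by apply: eq_bigr => i _; rewrite edge_length_sum_is_scalar mulrDr mulrCA.
Qed.

HB.instance Definition _ (R : realType) (n : nat) :=
  GRing.isLinear.Build R (edge_space R n) R *%R (@circlet R n)
    (@circlet_is_scalar R n).

(* Main.v *)
Require Import Defs.
From HB Require Import structures.
From mathcomp Require Import all_boot all_order all_algebra.
From mathcomp Require Import boolp classical_sets reals.
From mathcomp Require Import zify ring lra.

(** Let d = n/2, which is even. Multiplication by d + 1 is an involution of Z/n. In the
    coordinate z for which the vertex is (d + 1)z, the cost of an edge is d minus
    the circular distance of its ends ([coeff_relabel]), that is, the number of those
    antipodal cuts of the circle (there are d) that do not separate them
    ([coincidence_val]).

    Validity. A tour has an even number of edges inside the two sides of a given
    cut, and none only when it alternates between the sides. No tour alternates for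
    two different cuts, so the cost is at least 2(d - 1) = n - 2
    ([agreement_cycle_ge]).

    Facet. By duality ([facet_definingP]) it is enough that every linear functional
    constant on the tight tours (those of cost n - 2) is, on all tours, an affine
    function of the cost. Let w(x, y) be the weight that such a functional gives to the
    edge with coordinates x and y. Two tight tours that differ by a 2-opt move yield
    a relation between four values of w. The zigzag tours a + d, a, a + 1 + d, a + 1, ...
    are tight, and 2-opt moves starting from them give enough relations
    ([cross_exchange], [shift_exchange]) to show that the mixed second differences
    of w vanish away from equal and antipodal pairs, provided that w(x, x), which
    has no meaning, is chosen well. Periodicity then makes the antipodal
    differences opposite to the diagonal ones, and these are all equal. The cost
    function has mixed differences of the same shape, so w = lam * cost + p(x) + p(y)
    ([circular_decomp]). Along a tour the terms p add up to a constant. *)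

Set Implicit Arguments.
Unset Strict Implicit.
Unset Printing Implicit Defensive.

Import Order.TTheory GRing.Theory Num.Theory.
Local Open Scope ring_scope.

(** * Affine hulls and facets *)

Section Facets.
Variables (R : realType) (V : vectType R).
Implicit Types (A S : set V) (f g : {scalar V}).

(** Among the subspaces contained in W take one of maximal dimension: adding
    the line of a vector of W outside it would contradict maximality. *)
Lemma linear_set_vspace (W : V -> Prop) : W 0 ->
  (forall (a : R) u v, W u -> W v -> W (a *: u + v)) ->
  exists U : {vspace V}, forall v, v \in U <-> W v.
Proof.
move=> W0 WD.
pose sub (k : nat) := `[< exists U : {vspace V}, \dim U = k /\ forall v, v \in U -> W v >].
have sub0 : exists k, sub k.
  exists 0%N; apply/asboolP; exists 0%VS; split; first exact: dimv0.
  by move=> v; rewrite memv0 => /eqP->.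
have subb k : sub k -> (k <= \dim {:V})%N.
  by move=> /asboolP[U [<- _]]; apply/dimvS/subvf.
case: (ex_maxnP sub0 subb) => k /asboolP[U [dU UW]] kmax.
exists U => v; split; first exact: UW.
move=> Wv; apply: contrapT => vU.
have /kmax : sub (\dim (U + <[v]>)).
  apply/asboolP; exists (U + <[v]>)%VS; split=> // w /memv_addP[u uU [x /vlineP[a ->] ->]].
  by rewrite addrC; apply: WD => //; apply: UW.
rewrite -dU => dle.
have : (U == U + <[v]>)%VS by rewrite eqEdim addvSl dle.
move=> /eqP e; apply: vU; rewrite e.
by apply: (subvP (addvSr U <[v]>)); exact: memv_line.
Qed.

Lemma affine_hull_sub S x : S x -> affine_hull S x.
Proof.
move=> Sx; exists 1%N, (fun=> 1), (fun=> x).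
by split=> //; rewrite big_ord1 // scale1r.
Qed.

(** The affine hull is the case t = 1. Letting the total weight t vary makes
    these combinations stable under sums and scalings, which the affine hull
    itself is not. *)
Definition weighted_comb S (t : R) (x : V) : Prop :=
  exists (m : nat) (w : 'I_m -> R) (p : 'I_m -> V),
    [/\ \sum_i w i = t, forall i, S (p i) & x = \sum_i w i *: p i].

Lemma weighted_combD S t u x y : weighted_comb S t x -> weighted_comb S u y ->
  weighted_comb S (t + u) (x + y).
Proof.
move=> [m1 [w1 [p1 [<- i1 ->]]]] [m2 [w2 [p2 [<- i2 ->]]]].
pose glue (T : Type) (h1 : 'I_m1 -> T) (h2 : 'I_m2 -> T) i :=
  match split i with inl j => h1 j | inr j => h2 j end.
have gluel T h1 h2 i : @glue T h1 h2 (lshift m2 i) = h1 i.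
  by rewrite /glue (unsplitK (inl i)).
have gluer T h1 h2 i : @glue T h1 h2 (rshift m1 i) = h2 i.
  by rewrite /glue (unsplitK (inr i)).
exists (m1 + m2)%N, (glue _ w1 w2), (glue _ p1 p2); split.
- by rewrite big_split_ord; congr (_ + _); apply: eq_bigr => i _; rewrite ?gluel ?gluer.
- by move=> i; rewrite /glue; case: (split i).
- by rewrite big_split_ord; congr (_ + _); apply: eq_bigr => i _; rewrite ?gluel ?gluer.
Qed.

Lemma weighted_combZ S t x (a : R) : weighted_comb S t x ->
  weighted_comb S (a * t) (a *: x).
Proof.
move=> [m [w [p [<- i ->]]]]; exists m, (fun j => a * w j), p.
split=> //; first by rewrite mulr_sumr.
by rewrite scaler_sumr; apply: eq_bigr => j _; rewrite scalerA.
Qed.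

Lemma affine_hull_line S x0 x y (a : R) :
  affine_hull S x0 -> affine_hull S x -> affine_hull S y ->
  affine_hull S (a *: (x - x0) + y).
Proof.
rewrite -[affine_hull S]/(weighted_comb S 1) => S0 Sx Sy.
have := weighted_combD (weighted_combD (weighted_combZ a Sx) (weighted_combZ (- a) S0)) Sy.
by rewrite scaleNr -scalerBr !mulr1 subrr add0r.
Qed.

(** Dimension makes sense for the affine hull of any nonempty set: it is a
    translate of a subspace, so no dimension has to be computed in advance. *)
Lemma affine_hull_vspace S x0 : affine_hull S x0 ->
  exists U : {vspace V}, forall x, affine_hull S x <-> x - x0 \in U.
Proof.
move=> Sx0.
have [||U UE] := @linear_set_vspace (fun v => affine_hull S (x0 + v)).
- by rewrite addr0.
- move=> a u v Su Sv; have := affine_hull_line a Sx0 Su Sv.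
  by rewrite addrAC subrr add0r addrCA.
by exists U => x; rewrite UE addrC subrK.
Qed.

Lemma has_affine_dim_vspace S x0 (U : {vspace V}) :
  (forall x, affine_hull S x <-> x - x0 \in U) -> has_affine_dim S (\dim U)%:Z.
Proof.
move=> UE; right; exists x0, U; split=> //; apply/seteqP; split=> x /=.
  by move=> /UE xU; exists (x - x0) => //; rewrite addrC subrK.
by move=> [u uU <-]; apply/UE; rewrite addrAC subrr add0r.
Qed.

(** Subtracting the projection on U kills U but not v, hence some coordinate of
    the difference is a functional of the required kind. *)
Lemma separating_functional (U : {vspace V}) v : v \notin U ->
  exists g : {scalar V}, (forall u, u \in U -> g u = 0) /\ g v != 0.
Proof.
move=> vU.
pose r w := w - projv U w.
have rv : r v != 0.
  by apply: contraNneq vU => /eqP; rewrite subr_eq0 => /eqP->; exact: memv_proj.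
have [i gi] : exists i, coord (vbasis fullv) i (r v) != 0.
  apply/existsP; apply: contraNT rv => /existsPn ci.
  rewrite (coord_vbasis (memvf (r v))) big1 // => i _.
  by have /negPn/eqP-> := ci i; rewrite scale0r.
pose g w : R := coord (vbasis fullv) i (r w).
have gl : scalar g.
  move=> a x y; rewrite /g /r linearP.
  have -> : a *: x + y - (a *: projv U x + projv U y) =
     a *: (x - projv U x) + (y - projv U y) by rewrite scalerBr opprD addrACA.
  by rewrite linearP.
pose gL := HB.pack_for {scalar V} g (GRing.isLinear.Build R V R *%R g gl).
exists gL; split=> // u uU.
by rewrite /= /g /r projv_id // subrr linear0.
Qed.

Lemma convex_hull_affine A x : convex_hull A x -> affine_hull A x.
Proof. by move=> [m [w [p [_ s i e]]]]; exists m, w, p. Qed.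

Lemma convex_hull_sub A x : A x -> convex_hull A x.
Proof.
move=> Ax; exists 1%N, (fun=> 1), (fun=> x).
by split=> //; rewrite big_ord1 // scale1r.
Qed.

Lemma affine_hull_affine A g (c : R) : (forall x, A x -> g x = c) ->
  forall x, affine_hull A x -> g x = c.
Proof.
move=> gA x [m [w [p [s i ->]]]]; rewrite linear_sum /=.
under eq_bigr do rewrite linearZ /= gA //.
by rewrite -mulr_suml s mul1r.
Qed.

Lemma convex_hull_ge A f (a0 : R) : (forall x, A x -> a0 <= f x) ->
  forall x, convex_hull A x -> a0 <= f x.
Proof.
move=> fA x [m [w [p [w0 s i ->]]]]; rewrite linear_sum /= -[a0]mul1r -s mulr_suml.
by apply: ler_sum => j _; rewrite linearZ /= ler_wpM2l // fA.
Qed.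

(** The dual criterion for facets. Let U and U' be the directions of the polytope
    and of the face. If a vector u of U killed by f were outside U', a functional
    vanishing on U' but not at u would be constant on the points of A where f is
    minimal, hence affine in f over all of A, and so would vanish at u. Thus U' is
    the kernel of f on U, of codimension one since f is not constant on A. *)
Lemma facet_definingP A f (a0 : R) :
  (forall x, A x -> a0 <= f x) ->
  (exists x, A x /\ f x = a0) -> (exists x, A x /\ f x != a0) ->
  (forall g (c : R), (forall x, A x -> f x = a0 -> g x = c) ->
    exists lam kap : R, forall x, A x -> g x = lam * f x + kap) ->
  facet_defining (convex_hull A) f a0.
Proof.
move=> fA [x0 [Ax0 fx0]] [x1 [Ax1 fx1]] dual; split; first exact: convex_hull_ge.
pose P := convex_hull A; pose F := [set x | P x /\ f x = a0]%classic.
have Px0 : P x0 by exact: convex_hull_sub.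
have Fx0 : F x0 by [].
have [U UE] := affine_hull_vspace (affine_hull_sub Px0).
have [U' UE'] := affine_hull_vspace (affine_hull_sub Fx0).
have memU x : P x -> x - x0 \in U by move=> Px; apply/UE/affine_hull_sub.
have affF x : affine_hull F x -> f x = a0 by apply: affine_hull_affine => y [].
have U'U : (U' <= U)%VS.
  apply/subvP => u uU'; rewrite -[u](addrK x0); apply/UE.
  have /UE' [m [w [p [s i e]]]] : (u + x0) - x0 \in U' by rewrite addrK.
  by exists m, w, p; split=> // j; case: (i j).
pose fL : 'Hom(V, R^o) := linfun (f : V -> R^o).
have fLE x : fL x = f x by rewrite lfunE.
have kerU : U' = (U :&: lker fL)%VS.
  apply/vspaceP => u; apply/idP/idP; rewrite memv_cap.
    move=> uU'; rewrite (subvP U'U _ uU') memv_ker fLE.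
    have /UE'/affF : (u + x0) - x0 \in U' by rewrite addrK.
    rewrite linearD /= fx0 => e; apply/eqP; apply: (addIr a0).
    by rewrite e add0r.
  rewrite memv_ker fLE => /andP[uU /eqP fu]; apply: contraT => uU'.
  have [g [gU' gu]] := separating_functional uU'.
  have [|lam [kap gE]] := dual g (g x0).
    move=> x Ax fx; apply/eqP; rewrite -subr_eq0 -linearB; apply/eqP/gU'/UE'.
    by apply: affine_hull_sub; split=> //; exact: convex_hull_sub.
  have hE x : affine_hull P x -> g x - lam * f x = kap.
    move=> Px.
    pose h w : R := g w - lam * f w.
    have hl : scalar h by move=> a y z; rewrite /h !linearP /=; ring.
    pose hL := HB.pack_for {scalar V} h (GRing.isLinear.Build R V R *%R h hl).
    apply: (affine_hull_affine (g := hL) _ Px) => y Py.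
    apply: (affine_hull_affine (g := hL) _ (convex_hull_affine Py)) => z Az.
    by rewrite /= /h gE //; ring.
  have /UE/hE : (u + x0) - x0 \in U by rewrite addrK.
  rewrite !linearD /= fu; have /hE := affine_hull_sub Px0 => <- e.
  by case/eqP: gu; apply: subr0_eq; rewrite -[RHS](subrr (g x0 - lam * f x0)) -{1}e; ring.
have fU : (fL @: U)%VS = fullv.
  apply/eqP; rewrite eqEdim subvf dimvf /dim /= lt0n dimv_eq0.
  apply/eqP => e; have : fL (x1 - x0) \in (fL @: U)%VS by apply/memv_img/memU/convex_hull_sub.
  rewrite e memv0 fLE linearB /= fx0 subr_eq0; exact/negP.
exists (\dim U)%:Z; split; first exact: has_affine_dim_vspace UE.
have -> : (\dim U)%:Z - 1 = (\dim U')%:Z.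
  by rewrite -(limg_ker_dim fL U) -kerU fU dimvf /dim /= PoszD addrK.
exact: has_affine_dim_vspace UE'.
Qed.

End Facets.

(** * Weights of closed walks and tours *)

Section CycleWeight.
Variables (V : nmodType).

Definition walk_weight (T : Type) (w : T -> T -> V) x (p : seq T) : V :=
  \sum_(r <- pairmap w x p) r.

(** The weights run along consecutive entries of a list rather than through
    [next], so that cutting and reversing blocks is plain list algebra, and so that
    it applies to lists over nat whose entries only matter modulo n. *)
Definition cycle_weight (T : Type) (w : T -> T -> V) (s : seq T) : V :=
  if s is x :: p then walk_weight w x (rcons p x) else 0.

Lemma walk_weight_nil T (w : T -> T -> V) x : walk_weight w x [::] = 0.
Proof. exact: big_nil. Qed.

Lemma walk_weight_cons T (w : T -> T -> V) x y p :
  walk_weight w x (y :: p) = w x y + walk_weight w y p.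
Proof. exact: big_cons. Qed.

Lemma walk_weight_cat T (w : T -> T -> V) x p q :
  walk_weight w x (p ++ q) = walk_weight w x p + walk_weight w (last x p) q.
Proof. by rewrite /walk_weight pairmap_cat big_cat. Qed.

Lemma walk_weight_rcons T (w : T -> T -> V) x p y :
  walk_weight w x (rcons p y) = walk_weight w x p + w (last x p) y.
Proof. by rewrite -cats1 walk_weight_cat walk_weight_cons walk_weight_nil addr0. Qed.

Lemma walk_weight_rev T (w : T -> T -> V) x p : (forall x y, w x y = w y x) ->
  walk_weight w (last x p) (rev (belast x p)) = walk_weight w x p.
Proof.
move=> wC; elim: p x => //= y p IH x.
rewrite rev_cons walk_weight_rcons IH walk_weight_cons addrC; congr (_ + _).
rewrite wC; congr w; case: p {IH} => //= z p.
by rewrite rev_cons last_rcons.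
Qed.

Lemma cycle_weight_map T T' (h : T -> T') (w : T' -> T' -> V) s :
  cycle_weight w (map h s) = cycle_weight (fun x y => w (h x) (h y)) s.
Proof.
case: s => //= x p; rewrite -map_rcons.
by move: (rcons p x) => q; elim: q x => [|y q IH] x /=;
  rewrite ?walk_weight_nil // !walk_weight_cons IH.
Qed.

Lemma cycle_weight_next (T : eqType) (w : T -> T -> V) s : uniq s ->
  cycle_weight w s = \sum_(v <- s) w v (next s v).
Proof.
case: s => [|x p] us; first by rewrite big_nil.
rewrite -(big_map (fun v => w v (next (x :: p) v)) xpredT id); congr bigop.
apply: (@eq_from_nth _ 0) => [|i]; rewrite size_pairmap size_rcons ?size_map // => ip.
rewrite (nth_pairmap x) ?size_rcons // (nth_map x) // next_nth mem_nth // index_uniq //.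
congr w; first by rewrite -rcons_cons nth_rcons ip.
rewrite nth_rcons; have [//|pi] := ltnP i (size p).
by rewrite [RHS]nth_default // if_same.
Qed.

(** Reversing the block B only replaces the two edges joining it to A. *)
Lemma two_opt T (w : T -> T -> V) x0 A B : (forall x y, w x y = w y x) ->
  (0 < size A)%N -> (0 < size B)%N ->
  cycle_weight w (A ++ B) + (w (last x0 A) (last x0 B) + w (head x0 B) (head x0 A)) =
  cycle_weight w (A ++ rev B) + (w (last x0 A) (head x0 B) + w (last x0 B) (head x0 A)).
Proof.
case: A B => [|a A] [|b B] // wC _ _.
have -> : rev (b :: B) = last b B :: rev (belast b B) by rewrite lastI rev_rcons.
rewrite /= !rcons_cat !rcons_cons !walk_weight_cat !walk_weight_cons !walk_weight_rcons.
rewrite walk_weight_rev //; have -> : last (last b B) (rev (belast b B)) = b.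
  by case: B => //= z B; rewrite rev_cons last_rcons.
rewrite -!addrA; congr (_ + _); rewrite addrCA [RHS]addrCA; congr (_ + _).
by rewrite addrA addrC -addrA.
Qed.

End CycleWeight.

Lemma next_neq (T : eqType) (s : seq T) x : uniq s -> (1 < size s)%N -> x \in s ->
  next s x != x.
Proof.
move=> us s1 /rot_to[i p e]; rewrite -(next_rot i us).
move: us s1; rewrite -(rot_uniq i) -(size_rot i) e; case: p {e} => //= y p.
by rewrite eqxx inE negb_or eq_sym => /andP[/andP[]].
Qed.

Lemma next_next_neq (T : eqType) (s : seq T) x : uniq s -> (2 < size s)%N -> x \in s ->
  next s (next s x) != x.
Proof.
move=> us s1 /rot_to[i p e]; rewrite -!(next_rot i us).
move: us s1; rewrite -(rot_uniq i) -(size_rot i) e; case: p {e} => //= y [|z p] //=.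
rewrite eqxx !inE !negb_or => /andP[/and3P[xy xz _] _] _.
by rewrite [y == x]eq_sym (negbTE xy) eqxx eq_sym.
Qed.

Section Incidence.
Variables (R : realType) (n : nat).

Definition pair_vec (u v : 'I_n) : edge_space R n :=
  [ffun e => (val e == [set u; v]%SET)%:R].

Lemma pair_vecC u v : pair_vec u v = pair_vec v u.
Proof. by apply/ffunP => e; rewrite !ffunE finset.setUC. Qed.

Definition tour_edges (s : seq 'I_n) : {set edge n} :=
  [set e : edge n | [exists v, val e == [set v; next s v]%SET]]%SET.

Lemma mem_of_size (s : seq 'I_n) : uniq s -> size s = n -> forall v, v \in s.
Proof.
move=> us sn v; have [|_ ->] := uniq_min_size us (fun v _ => mem_enum 'I_n v).
  by rewrite size_enum_ord sn.
exact: mem_enum.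
Qed.

Lemma size_of_mem (s : seq 'I_n) : uniq s -> (forall v, v \in s) -> size s = n.
Proof.
move=> us full; rewrite -(card_uniqP us) -[RHS]card_ord.
by apply: eq_card => v; rewrite full.
Qed.

Lemma hamiltonian_tour s : (2 < n)%N -> uniq s -> size s = n ->
  hamiltonian_cycle (tour_edges s).
Proof.
move=> n2 us sn; exists s; split=> //; [by rewrite sn| |exact: mem_of_size].
rewrite /ucycle us andbT; apply: cycle_from_next => // x xs.
by rewrite eq_sym next_neq // sn; lia.
Qed.

Lemma incidence_tour s : uniq s -> (2 < size s)%N -> (forall v, v \in s) ->
  incidence R (tour_edges s) = \sum_(v <- s) pair_vec v (next s v).
Proof.
move=> us s2 full; apply/ffunP => e; rewrite sum_ffunE !ffunE inE.
under eq_bigr do rewrite ffunE.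
rewrite big_uniq //=; case: existsP => [[v ev]|ne].
  rewrite (bigD1 v) ?full //= ev big1 ?addr0 // => u /andP[_ uv].
  rewrite (eqP ev); case: eqP => // /setP eq.
  have := eq v; rewrite !inE eqxx (eq_sym v u) (negbTE uv) => /esym/eqP vE.
  have := eq u; rewrite !inE eqxx (negbTE uv) => /eqP uE.
  by have := next_next_neq us s2 (full v); rewrite -uE -vE eqxx.
rewrite big1 // => v _; case: eqP => // ev; case: ne; exists v; exact/eqP.
Qed.

(** By linearity a functional on the edge space evaluates on a tour as the sum of its
    values at the edges; three or more vertices are needed so that the edges met
    along the tour are distinct. *)
Lemma linear_incidence (g : {scalar edge_space R n}) s :
  uniq s -> (2 < size s)%N -> (forall v, v \in s) ->
  g (incidence R (tour_edges s)) = cycle_weight (fun u v => g (pair_vec u v)) s.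
Proof.
by move=> us s2 full; rewrite incidence_tour // linear_sum cycle_weight_next.
Qed.

End Incidence.

(** * The cost of an edge *)

Section PairCost.
Variables (R : realType) (n : nat).
Implicit Types u v : 'I_n.

Lemma pair_lengthC u v : pair_length u v = pair_length v u.
Proof. by rewrite /pair_length distnC. Qed.

Lemma pair_length_bounds u v : u != v -> (1 <= pair_length u v < n./2.+1)%N.
Proof.
rewrite -val_eqE /pair_length => /=; have := ltn_ord u; have := ltn_ord v.
by move: (u : nat) (v : nat) => a b; lia.
Qed.

Lemma edge_has_length_pair i (e : edge n) u v : val e = [set u; v]%SET ->
  edge_has_length i e = (pair_length u v == i).
Proof.
move=> ev; apply/existsP/idP => [[u' /existsP[v' /andP[/eqP]]]|/eqP <-]; last first.
  by exists u; apply/existsP; exists v; rewrite ev !eqxx.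
have : u != v by have := valP e; rewrite ev cards2; case: (u != v).
rewrite ev => uv /setP E; have := E u; have := E v; have := E u'; have := E v'.
rewrite !inE !eqxx ?orbT /=.
case/orP=> /eqP-> /orP[] /eqP-> //; rewrite ?eqxx ?(eq_sym v u) ?(negbTE uv) //.
by rewrite pair_lengthC.
Qed.

Lemma edge_length_sum_pair i u v : u != v ->
  edge_length_sum i (pair_vec R u v) = (pair_length u v == i)%:R.
Proof.
move=> uv; have ce : #|[set u; v]%SET| == 2%N by rewrite cards2 uv.
pose e0 : edge n := Sub [set u; v]%SET ce.
have e0E : val e0 = [set u; v]%SET by [].
rewrite /edge_length_sum -(edge_has_length_pair i e0E).
under eq_bigr do rewrite ffunE.
have [h|h] := boolP (edge_has_length i e0).
  rewrite (bigD1 e0) //= eqxx big1 ?addr0 // => e /andP[_ ee].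
  by rewrite -e0E val_eqE (negbTE ee).
rewrite big1 // => e he; rewrite -e0E val_eqE.
by case: eqP => // ee; rewrite -ee he in h.
Qed.

Lemma circlet_pair u v : u != v ->
  circlet (pair_vec R u v) = (circlet_coeff n./2 (pair_length u v))%:R.
Proof.
move=> uv; rewrite /circlet.
under eq_bigr do rewrite edge_length_sum_pair //.
rewrite (bigD1_seq (pair_length u v)) ?mem_index_iota ?pair_length_bounds ?iota_uniq //=.
by rewrite eqxx mulr1 big1 ?addr0 // => i; rewrite eq_sym => /negbTE->; rewrite mulr0.
Qed.

End PairCost.

(** * Cuts of an even cycle *)

Section CycleCuts.
Variables (T : eqType) (d : nat) (side : 'I_d -> T -> bool).

(** A family of d bipartitions of the vertices is given by its indicators [side];
    an edge costs one for each bipartition that does not separate its ends. *)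
Definition agreement (u v : T) : nat := (\sum_(a < d) (side a u == side a v))%N.

(** Modulo 2 a step contributes 1 plus the change of side, and the changes of
    side telescope. *)
Lemma odd_walk_agreement (tau : T -> bool) x p :
  odd (walk_weight (fun u v => (tau u == tau v) : nat) x p) =
  tau x (+) tau (last x p) (+) odd (size p).
Proof.
elim: p x => [|y p IH] x; first by rewrite walk_weight_nil /= addbb.
rewrite walk_weight_cons /= oddD IH.
by move: (tau x) (tau y) (tau (last y p)) (odd (size p)) => [] [] [] [].
Qed.

Lemma odd_cycle_agreement (tau : T -> bool) s : ~~ odd (size s) ->
  ~~ odd (cycle_weight (fun u v => (tau u == tau v) : nat) s).
Proof.
case: s => [|x p] //= sz.
by rewrite odd_walk_agreement size_rcons last_rcons addbb.
Qed.

Lemma cycle_const (tau : T -> bool) s : uniq s ->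
  (forall v, v \in s -> tau v = tau (next s v)) ->
  {in s &, forall u v, tau u = tau v}.
Proof.
case: s => // x p us inv.
have /= : cycle (fun u v => tau u == tau v) (x :: p).
  by apply: cycle_from_next => // v /inv ->.
move/order_path_min => /(_ _)/allP h.
have {}h u : u \in x :: p -> tau x = tau u.
  move=> ux; apply/eqP/h; last by rewrite mem_rcons.
  by move=> a b c /eqP-> /eqP->.
by move=> u v /h <- /h <-.
Qed.

(** On an even cycle each bipartition leaves an even number of edges unseparated.
    That number is 0 only if the cycle alternates between the two sides, which
    cannot happen for two bipartitions that agree at one vertex and differ at
    another. So all of the d bipartitions but one contribute at least 2. *)
Lemma agreement_cycle_ge s : uniq s -> ~~ odd (size s) ->
  (forall a b : 'I_d, (a < b)%N -> exists u v,
    [/\ u \in s, v \in s, side a u = side b u & side a v != side b v]) ->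
  ((d + d) - 2 <= cycle_weight agreement s)%N.
Proof.
move=> us even dist; rewrite cycle_weight_next //.
pose D (a : 'I_d) := (\sum_(v <- s) (side a v == side a (next s v)) : nat)%N.
have -> : \sum_(v <- s) agreement v (next s v) = (\sum_a D a)%N.
  by rewrite /agreement exchange_big.
have D2 a : D a != 0%N -> (2 <= D a)%N.
  have := odd_cycle_agreement (side a) even; rewrite cycle_weight_next //.
  by rewrite -/(D a); case: (D a) => [|[|]].
have alt a : D a = 0%N -> forall v, v \in s -> side a (next s v) = ~~ side a v.
  move=> /eqP; rewrite /D sum_nat_seq_eq0 => /allP h v /h /=.
  by move: (side a v) (side a (next s v)) => [] [].
have D0 a b : D a = 0%N -> D b = 0%N -> (a < b)%N -> False.
  move=> a0 b0 /dist [u [v [us' vs eu]]] /negP; apply; apply/eqP.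
  have := @cycle_const (fun v => side a v (+) side b v) s us _ u v us' vs.
  rewrite eu addbb => h; apply/eqP; rewrite -negb_add -h // => w ws.
  by rewrite (alt a) // (alt b) //; case: (side a w) (side b w) => [] [].
case: (pickP (fun a => D a == 0%N)) => [a0 /eqP Da0|nz].
  rewrite (bigD1 a0) //= Da0.
  have : (\sum_(a < d | a != a0) 2 <= \sum_(a < d | a != a0) D a)%N.
    apply: leq_sum => a aa0; apply: D2; apply: contra aa0 => /eqP Da.
    by apply/eqP/val_inj => /=; case: (ltngtP a a0) => // /D0; case.
  by rewrite sum_nat_const cardC1 card_ord add0n; apply: leq_trans; lia.
have : (\sum_(a < d) 2 <= \sum_(a < d) D a)%N.
  by apply: leq_sum => a _; apply: D2; rewrite nz.
by rewrite sum_nat_const card_ord; apply: leq_trans; lia.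
Qed.

End CycleCuts.

(** * Antipodal cuts and circular coordinates *)

Section AntipodalCuts.
Variable d : nat.
Hypothesis d_gt0 : (0 < d)%N.

(** The points 0, ..., 2d-1 on a circle are cut into two arcs of d consecutive
    points; as a runs over 0, ..., d-1 these are all the antipodal cuts. The
    parity of the quotient makes the function 2d-periodic on nat. *)
Definition arc_side (a z : nat) : bool := odd ((z + a) %/ d).
Definition coincidence (x y : nat) : nat := (\sum_(a < d) (arc_side a x == arc_side a y))%N.

Lemma arc_sideD a z : arc_side a (z + (d + d)) = arc_side a z.
Proof.
rewrite /arc_side; have -> : (z + (d + d) + a = 2 * d + (z + a))%N by lia.
by rewrite divnMDl // oddD.
Qed.

(** Hermite's identity. Passing from x to x.+1 replaces the term x %/ d of the sum
    by (x + d) %/ d, which is larger by one. *)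
Lemma sum_divn_shift x : (\sum_(a < d) (x + a) %/ d = x)%N.
Proof.
elim: x => [|x IH].
  by rewrite big1 // => a _; rewrite add0n divn_small.
move: d_gt0 IH; case: d => // d' _.
rewrite big_ord_recl big_ord_recr /= => IH.
have -> : (\sum_(i < d') (x.+1 + i) %/ d'.+1 = \sum_(i < d') (x + bump 0 i) %/ d'.+1)%N.
  by apply: eq_bigr => i _; rewrite addnS.
have -> : (x.+1 + d' = d'.+1 + x)%N by lia.
by rewrite divnDl // divnn /= -[in RHS]IH addn0; lia.
Qed.

Lemma coincidenceC x y : coincidence x y = coincidence y x.
Proof. by apply: eq_bigr => a _; rewrite eq_sym. Qed.

Lemma coincidenceDl x y : coincidence (x + (d + d)) y = coincidence x y.
Proof. by apply: eq_bigr => a _; rewrite arc_sideD. Qed.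

(** Two points at circular distance k are separated by exactly k of the antipodal
    cuts: a cut separates x from x + k when the quotient jumps by one, and by
    Hermite's identity the jumps add up to k. *)
Lemma coincidence_val x k : (k <= d)%N -> coincidence x (x + k) = (d - k)%N.
Proof.
move=> kd.
have step (a : 'I_d) : ((arc_side a x == arc_side a (x + k)) + (x + k + a) %/ d = 1 + (x + a) %/ d)%N.
  rewrite /arc_side addnAC; move: (x + a)%N => m; rewrite {1 2 3}(divn_eq m d) -addnA.
  rewrite !divnMDl //; have rd := ltn_pmod m d_gt0; move: (m %% d)%N (m %/ d)%N rd => r q rd.
  rewrite [(r %/ d)%N]divn_small // addn0 oddD; have [h|h] := ltnP (r + k) d.
    by rewrite divn_small // addbF eqxx addn0.
  have -> : (r + k = 1 * d + (r + k - d))%N by lia.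
  rewrite divnMDl // divn_small ?addn0; last by lia.
  by rewrite addbT; case: (odd q); rewrite /= addn1.
have : (\sum_(a < d) ((arc_side a x == arc_side a (x + k)) + (x + k + a) %/ d) =
        \sum_(a < d) (1 + (x + a) %/ d))%N.
  by apply: eq_bigr => a _; exact: step.
rewrite !big_split /= !sum_divn_shift sum1_card card_ord -/(coincidence x (x + k)); lia.
Qed.

Lemma arc_side_distinct (a b : nat) : (a < b < d)%N ->
  arc_side a 0 = arc_side b 0 /\ arc_side a (d - b) != arc_side b (d - b).
Proof.
move=> ab; have bd : (b <= d)%N by lia.
rewrite /arc_side !add0n subnK // divnn d_gt0 !divn_small //; lia.
Qed.

Let n := (d + d)%N.

Lemma circular_close x y : x != y %[mod n] ->
  exists2 k, (0 < k <= d)%N & (y = x + k %[mod n])%N \/ (x = y + k %[mod n])%N.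
Proof.
have n0 : (0 < n)%N by rewrite /n; lia.
move=> xy; have xn := ltn_pmod x n0; have yn := ltn_pmod y n0.
have key u v : (v < n)%N -> (u < v)%N ->
    exists2 k, (0 < k <= d)%N & (v = u + k %[mod n])%N \/ (u = v + k %[mod n])%N.
  move=> vn uv; have [h|h] := leqP (v - u) d.
    by exists (v - u)%N; [lia|left; rewrite subnKC // ltnW].
  exists (u + n - v)%N; first by rewrite /n in vn *; lia.
  by right; rewrite subnKC ?modnDr //; rewrite /n in vn *; lia.
case: (ltngtP (x %% n) (y %% n)) => [lt|lt|e]; last by rewrite e eqxx in xy.
  have [k kd h] := key _ _ yn lt; exists k => //.
  by move: h; rewrite !modn_mod !modnDml.
have [k kd h] := key _ _ xn lt; exists k => //.
by move: h; rewrite !modn_mod !modnDml; case; [right|left].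
Qed.

End AntipodalCuts.

Section Relabel.
Variable d : nat.
Hypotheses (d_gt0 : (0 < d)%N) (d_even : ~~ odd d).
Let n := (d + d)%N.

Lemma double_gt0 : (0 < d + d)%N. Proof. by rewrite addn_gt0 d_gt0. Qed.

(** The vertex with circular coordinate z. As d is even, (d + 1)^2 is 1 modulo 2d,
    so the change of coordinates is its own inverse. *)
Definition relabel (z : nat) : 'I_(d + d) := Ordinal (ltn_pmod (d.+1 * z) double_gt0).

Lemma sqr_half_mod : (d * d = 0 %[mod d + d])%N.
Proof.
have -> : (d * d = d./2 * (d + d))%N.
  by have := odd_double_half d; rewrite (negbTE d_even); nia.
by rewrite modnMl mod0n.
Qed.

Lemma relabel_eqmod x y : (relabel x == relabel y) = (x == y %[mod d + d]).
Proof.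
rewrite -val_eqE /=; apply/eqP/eqP => [e|e]; last by rewrite -modnMmr e modnMmr.
have inv z : (d.+1 * (d.+1 * z) = z %[mod d + d])%N.
  have -> : (d.+1 * (d.+1 * z) = z + z * (d + d) + z * (d * d))%N by ring.
  by rewrite -modnDmr -modnMmr sqr_half_mod mod0n muln0 mod0n addn0 [(_ + z * _)%N]addnC modnMDl.
by rewrite -[LHS]inv -modnMmr e modnMmr inv.
Qed.

Lemma relabelK (v : 'I_(d + d)) : relabel (d.+1 * v) = v.
Proof.
apply: val_inj => /=; rewrite -[RHS](modn_small (ltn_ord v)).
have -> : (d.+1 * (d.+1 * v) = v + v * (d + d) + v * (d * d))%N by ring.
by rewrite -modnDmr -modnMmr sqr_half_mod mod0n muln0 mod0n addn0 [(_ + v * _)%N]addnC modnMDl.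
Qed.

Lemma pair_length_shift (u v : 'I_(d + d)) k : (k <= d)%N ->
  (v = u + k %[mod d + d])%N -> pair_length u v = k.
Proof.
move=> kd; rewrite /pair_length (modn_small (ltn_ord v)).
have := ltn_ord u; have := ltn_ord v; move: (u : nat) (v : nat) => a b bn an e.
have [h|h] := ltnP (a + k) (d + d).
  by rewrite modn_small // in e; lia.
have e2 : (a + k = 1 * (d + d) + (a + k - (d + d)))%N by lia.
rewrite e2 modnMDl modn_small in e; lia.
Qed.

(** Multiplication by d + 1 preserves an even displacement k, of cost d - k, and
    turns an odd one into k + d, of length d - k and hence of cost d - k as well. *)
Lemma coeff_relabel_shift x k : (0 < k <= d)%N ->
  circlet_coeff d (pair_length (relabel x) (relabel (x + k))) = (d - k)%N.
Proof.
move=> kd; rewrite /circlet_coeff; have [ok|ek] := boolP (odd k).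
  rewrite pair_lengthC (@pair_length_shift _ _ (d - k)) ?leq_subr //=.
    by rewrite oddB ?(negbTE d_even) ?ok //; lia.
  rewrite modnDml mulnDr -addnA.
  have -> : (d.+1 * k + (d - k) = (k./2 + 1) * (d + d))%N.
    by have := odd_double_half k; rewrite ok; nia.
  by rewrite modn_mod [(d.+1 * x + _)%N]addnC modnMDl.
rewrite (@pair_length_shift _ _ k) ?(negbTE ek) //=; first by lia.
rewrite modn_mod modnDml mulnDr.
have -> : (d.+1 * k = k./2 * (d + d) + k)%N.
  by have := odd_double_half k; rewrite (negbTE ek); nia.
by rewrite addnCA modnMDl.
Qed.

Lemma coincidence_mod x y z : (x = y %[mod d + d])%N -> coincidence d x z = coincidence d y z.
Proof.
have red m : coincidence d (m %% (d + d)) z = coincidence d m z.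
  rewrite [in RHS](divn_eq m (d + d)) addnC; elim: (m %/ _)%N => [|q IH].
    by rewrite addn0.
  by rewrite mulSn addnCA addnC coincidenceDl.
by move=> e; rewrite -red e red.
Qed.

Lemma coeff_relabel x y : x != y %[mod d + d] ->
  circlet_coeff d (pair_length (relabel x) (relabel y)) = coincidence d x y.
Proof.
have rel u v : (u = v %[mod d + d])%N -> relabel u = relabel v.
  by move/eqP; rewrite -relabel_eqmod => /eqP.
have main a b k : (0 < k <= d)%N -> (b = a + k %[mod d + d])%N ->
    circlet_coeff d (pair_length (relabel a) (relabel b)) = coincidence d a b.
  move=> kd e; rewrite (rel _ _ e) coeff_relabel_shift // coincidenceC.
  by rewrite (coincidence_mod _ e) coincidenceC coincidence_val //; lia.
move=> /(circular_close d_gt0)[k kd [e|e]]; first exact: main kd e.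
by rewrite pair_lengthC coincidenceC; exact: main kd e.
Qed.

End Relabel.

(** * Mixed differences of periodic functions *)

Section Core.
Variables (R : realFieldType).
Implicit Types (G : nat -> nat -> R).

(** It vanishes identically exactly for functions of the form p x + q y. *)
Definition mixed_diff G (x y : nat) : R :=
  G x.+1 y.+1 - G x.+1 y - G x y.+1 + G x y.

Lemma mixed_diff_sum G x y m :
  \sum_(j < m) mixed_diff G x (y + j)%N =
  G x.+1 (y + m)%N - G x.+1 y - G x (y + m)%N + G x y.
Proof.
elim: m => [|m IH]; first by rewrite big_ord0 addn0; ring.
by rewrite big_ord_recr /= IH /mixed_diff addnS; ring.
Qed.

Lemma mixed_diff_eq0 G : (forall x y, mixed_diff G x y = 0) ->
  forall x y, G x y = G x 0 + G 0 y - G 0 0.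
Proof.
move=> G0; elim=> [|x IH] y; first by ring.
have := mixed_diff_sum G x 0 y.
rewrite big1 ?add0n => [/eqP|j _ //]; rewrite eq_sym => /eqP e.
have -> : G x.+1 y = G x.+1 0%N + G x y - G x 0%N by apply: subr0_eq; rewrite -e; ring.
by rewrite (IH y); ring.
Qed.

Section Periodic.
Variables (d : nat) (G : nat -> nat -> R).
Hypothesis d_gt1 : (1 < d)%N.
Let n := (d + d)%N.
Hypotheses (G_sym : forall x y, G x y = G y x)
           (G_per : forall x y, G (x + n)%N y = G x y).

Lemma G_perr x y : G x (y + n)%N = G x y.
Proof. by rewrite G_sym G_per G_sym. Qed.

Lemma mixed_diff_sym x y : mixed_diff G x y = mixed_diff G y x.
Proof.
by rewrite /mixed_diff ![G y.+1 _]G_sym ![G y _]G_sym; ring.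
Qed.

Lemma mixed_diff_perr x y : mixed_diff G x (y + n)%N = mixed_diff G x y.
Proof. by rewrite /mixed_diff -!addSn !G_perr. Qed.

(** By symmetry and periodicity, pairs at circular distance at most d suffice. *)
Lemma mixed_diff_eq0_half :
  (forall x k, (k <= d)%N -> mixed_diff G x (x + k)%N = 0) ->
  forall x y, mixed_diff G x y = 0.
Proof.
move=> H.
have H1 x k : mixed_diff G x (x + k)%N = 0.
  have -> : (x + k = x + k %% n + k %/ n * n)%N by rewrite {1}(divn_eq k n); lia.
  elim: (k %/ n)%N => [|m IH]; last by rewrite mulSn addnCA addnC mixed_diff_perr.
  rewrite mul0n addn0; have : (k %% n < n)%N by rewrite ltn_mod /n; lia.
  move: (k %% n)%N => j jn; have [/H//|dj] := leqP j d.
  rewrite mixed_diff_sym -mixed_diff_perr.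
  have -> : (x + n = x + j + (n - j))%N by lia.
  by apply: H; rewrite /n in jn *; lia.
move=> x y; case: (leqP x y) => [xy|/ltnW yx].
  by have := H1 x (y - x)%N; rewrite subnKC.
by rewrite mixed_diff_sym; have := H1 y (x - y)%N; rewrite subnKC.
Qed.

Hypothesis zero : forall x k, (0 < k < d)%N -> mixed_diff G x (x + k)%N = 0.

(** Over a full period the mixed differences of a row telescope to 0, and only
    the diagonal and the antipodal one can be nonzero. *)
Lemma mixed_diff_antipode x : mixed_diff G x (x + d)%N = - mixed_diff G x x.
Proof.
have := mixed_diff_sum G x x n; rewrite !G_perr.
have -> (a c : R) : a - a - c + c = 0 by ring.
have Zr k : (d < k < n)%N -> mixed_diff G x (x + k)%N = 0.
  rewrite /n => kn; rewrite mixed_diff_sym -mixed_diff_perr.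
  have -> : (x + n = x + k + (n - k))%N by rewrite /n; lia.
  by apply: zero; rewrite /n; lia.
have n0 : (0 < n)%N by rewrite /n; lia.
have dn : (d < n)%N by rewrite /n; lia.
rewrite (bigD1 (Ordinal n0)) //= addn0 (bigD1 (Ordinal dn)) //=; last first.
  by rewrite -val_eqE /=; lia.
rewrite big1 ?addr0 => [/eqP|[j jn] /=]; first by rewrite addr_eq0 => /eqP->; ring.
rewrite -!val_eqE /= => /andP[j0 jd].
by have [jltd|dj] := ltnP j d; [apply: zero; lia|apply: Zr; lia].
Qed.


Lemma mixed_diff_diag_antiperiod x :
  mixed_diff G (x + d)%N (x + d)%N = mixed_diff G x x.
Proof.
apply: oppr_inj; rewrite -mixed_diff_antipode -addnA mixed_diff_perr.
by rewrite mixed_diff_sym mixed_diff_antipode.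
Qed.

Hypothesis shift : forall a,
  G (a + d).-1%N a - G (a + d).-1%N (a + d)%N = G (a + d).+1%N a - G (a + d).+1%N (a + d)%N.

(** The hypothesis [shift] says that the mixed differences over a rectangle of
    two rows and d columns add up to 0. This rectangle contains one diagonal and one
    antipodal entry, which gives period d - 1 along the diagonal; with period d,
    the diagonal is constant. *)
Lemma mixed_diff_diag_const x : mixed_diff G x x = mixed_diff G 0 0.
Proof.
elim: x => // x <-; set a := x.+1.
suff: mixed_diff G x.+1 x.+1 = mixed_diff G (x + d)%N (x + d)%N.
  by rewrite mixed_diff_diag_antiperiod.
have e : (a + d).-1%N = (x + d)%N by rewrite /a; lia.
have s0 := mixed_diff_sum G (x + d)%N a d.
have s1 := mixed_diff_sum G (x + d).+1%N a d.
have {s0} s0 : mixed_diff G (x + d)%N (x + d)%N =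
    G (x + d).+1%N (a + d)%N - G (x + d).+1%N a - G (x + d)%N (a + d)%N + G (x + d)%N a.
  have ld : (d.-1 < d)%N by lia.
  rewrite -s0 (bigD1 (Ordinal ld)) //= big1 ?addr0 => [|[j jd] /=].
    by congr mixed_diff; rewrite /a; lia.
  rewrite -val_eqE /= => jd1; rewrite mixed_diff_sym.
  have -> : (x + d = a + j + (d.-1 - j))%N by rewrite /a; lia.
  by apply: zero; lia.
have {s1} s1 : - mixed_diff G a a =
    G (x + d).+2%N (a + d)%N - G (x + d).+2%N a - G (x + d).+1%N (a + d)%N + G (x + d).+1%N a.
  have ld : (0 < d)%N by lia.
  rewrite -s1 (bigD1 (Ordinal ld)) //= big1 ?addr0 => [|[j jd] /=].
    by rewrite addn0 mixed_diff_sym -mixed_diff_antipode.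
  rewrite -val_eqE /= => j0; rewrite mixed_diff_sym.
  have -> : ((x + d).+1%N = a + j + (d - j))%N by rewrite /a; lia.
  by apply: zero; lia.
have := shift a; rewrite e -[(a + d).+1%N]/(x + d).+2%N => h.
by rewrite s0 -[LHS]opprK s1; lra.
Qed.

End Periodic.

(** The comparison function C, which is d minus the circular distance, has mixed
    difference 2 on the diagonal, -2 at antipodal pairs and 0 elsewhere. A suitable
    multiple of C therefore removes all mixed differences of G. *)
Lemma circular_decomp (d : nat) (G C : nat -> nat -> R) : (1 < d)%N ->
    (forall x y, G x y = G y x) ->
    (forall x y, G (x + (d + d))%N y = G x y) ->
    (forall x k, (0 < k < d)%N -> mixed_diff G x (x + k) = 0) ->
    (forall a, G (a + d).-1%N a - G (a + d).-1%N (a + d)%N =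
               G (a + d).+1%N a - G (a + d).+1%N (a + d)%N) ->
    (forall x y, C x y = C y x) ->
    (forall x y, C (x + (d + d))%N y = C x y) ->
    (forall x k, (k <= d)%N -> C x (x + k)%N = (d - k)%:R) ->
  exists (lam : R) (p : nat -> R),
  forall x y, G x y = lam * C x y + p x + p y.
Proof.
move=> d_gt1 G_sym G_per zero shift C_sym C_per C_val.
pose lam := mixed_diff G 0 0 / 2.
pose F x y := G x y - lam * C x y.
have F_sym x y : F x y = F y x by rewrite /F G_sym C_sym.
have F_per x y : F (x + (d + d))%N y = F x y by rewrite /F G_per C_per.
have FE x y : mixed_diff F x y = mixed_diff G x y - lam * mixed_diff C x y.
  by rewrite /mixed_diff /F; ring.
have Cd x : mixed_diff C x x = 2.
  have C0 z : C z z = d%:R by have := C_val z 0%N (leq0n d); rewrite addn0 subn0.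
  have C1 z : C z z.+1 = d%:R - 1 by rewrite -addn1 C_val ?natrB //; lia.
  by rewrite /mixed_diff (C_sym x.+1 x) !C0 C1; ring.
have Fd x : mixed_diff F x x = 0.
  by rewrite FE Cd (mixed_diff_diag_const d_gt1) // /lam; field.
have Fz x k : (0 < k < d)%N -> mixed_diff F x (x + k)%N = 0.
  move=> kd; rewrite FE zero // /mixed_diff -!addnS.
  have -> : (x + k = x.+1 + k.-1)%N by lia.
  have -> : (x + k.+1 = x.+1 + k)%N by lia.
  rewrite !C_val; try lia.
  have -> : (x.+1 + k = x + k.+1)%N by lia.
  have -> : (x.+1 + k.-1 = x + k)%N by lia.
  rewrite !C_val ?natrB; try lia.
  have -> : k.-1%:R = k%:R - 1 :> R by rewrite -subn1 natrB //; lia.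
  by rewrite -addn1 natrD; ring.
have F0 : forall x y, mixed_diff F x y = 0.
  apply: (mixed_diff_eq0_half d_gt1) => // x k; rewrite leq_eqVlt => /orP[/eqP->|kd].
    by rewrite (mixed_diff_antipode d_gt1) ?Fd ?oppr0.
  case: k kd => [|k] kd; first by rewrite addn0.
  exact: Fz.
exists lam, (fun x => F x 0%N - F 0%N 0%N / 2) => x y.
have -> : G x y = F x y + lam * C x y by rewrite /F; ring.
by rewrite (mixed_diff_eq0 F0) (F_sym 0%N y); field.
Qed.

(** Here the values of G on the diagonal carry no information: in the application
    they belong to loops. They are redefined so that the mixed differences at
    distance one vanish too; at distance 2, ..., d-1 this is what the third
    hypothesis on G expresses. *)
Lemma circular_decomp_offdiag (d : nat) (G C : nat -> nat -> R) : (1 < d)%N ->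
    (forall x y, G x y = G y x) ->
    (forall x y, G (x + (d + d))%N y = G x y) ->
    (forall x k, (1 < k <= d)%N ->
      G x.+1 (x + k)%N - G x (x + k)%N = G x.+1 (x + d)%N - G x (x + d)%N) ->
    (forall a, G (a + d).-1%N a - G (a + d).-1%N (a + d)%N =
               G (a + d).+1%N a - G (a + d).+1%N (a + d)%N) ->
    (forall x y, C x y = C y x) ->
    (forall x y, C (x + (d + d))%N y = C x y) ->
    (forall x k, (k <= d)%N -> C x (x + k)%N = (d - k)%:R) ->
  exists (lam : R) (p : nat -> R),
  forall x y, x != y %[mod d + d] -> G x y = lam * C x y + p x + p y.
Proof.
move=> d_gt1 G_sym G_per exch shift C_sym C_per C_val; pose n := (d + d)%N.
have G_modl x y : G (x %% n)%N y = G x y.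
  rewrite [in RHS](divn_eq x n) addnC.
  elim: (x %/ n)%N => [|q IH]; first by rewrite addn0.
  by rewrite mulSn addnCA addnC G_per.
have G_mod x x' y y' : x = x' %[mod n] -> y = y' %[mod n] -> G x y = G x' y'.
  by move=> ex ey; rewrite -G_modl ex G_modl G_sym -G_modl ey G_modl G_sym.
(* The value at w.+1 is forced by the condition at the pair (w, w.+1); the
   predecessor of r modulo n is written (r + n).-1 because r may be 0. *)
pose diag x := let r := (x %% n)%N in G r r.+1 - G (r + n).-1 r.+1 + G (r + n).-1 r.
have diagE w : diag w.+1 = G w.+1 w.+2 - G w w.+2 + G w w.+1.
  have e1 : (w.+1 %% n = w.+1 %[mod n])%N by rewrite modn_mod.
  have e2 : ((w.+1 %% n).+1 = w.+2 %[mod n])%N by rewrite -addn1 modnDml addn1.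
  have e3 : ((w.+1 %% n + n).-1 = w %[mod n])%N.
    have -> : ((w.+1 %% n + n).-1 = w.+1 %% n + n.-1)%N.
      by rewrite -!subn1 addnBA // /n; lia.
    rewrite modnDml; have -> : (w.+1 + n.-1 = w + n)%N by clear e1 e2; rewrite /n; lia.
    by rewrite modnDr.
  by rewrite /diag (G_mod _ _ _ _ e1 e2) (G_mod _ _ _ _ e3 e2) (G_mod _ _ _ _ e3 e1).
pose H x y := if x == y %[mod n] then diag x else G x y.
have HG x y : x != y %[mod n] -> H x y = G x y by rewrite /H => /negbTE->.
have neqD x k : (0 < k < n)%N -> x + k != x %[mod n].
  by move=> kn; rewrite -{2}[x]addn0 eqn_modDl mod0n modn_small; lia.
have H_sym x y : H x y = H y x.
  rewrite /H eq_sym; case: eqP => [e|_]; last exact: G_sym.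
  by rewrite /diag e.
have H_per x y : H (x + n)%N y = H x y.
  by rewrite /H /diag modnDr G_per.
have HD x k : (0 < k < n)%N -> H x (x + k)%N = G x (x + k)%N.
  by move=> kn; rewrite HG // eq_sym neqD.
have HDS x k : (1 < k <= n)%N -> H x.+1 (x + k)%N = G x.+1 (x + k)%N.
  move=> kn; have -> : (x + k = x.+1 + k.-1)%N by lia.
  by rewrite HD //; lia.
have zero x k : (0 < k < d)%N -> mixed_diff H x (x + k) = 0.
  move=> kd; rewrite /mixed_diff; have [->|k1] := eqVneq k 1%N.
    rewrite addn1.
    have Hxx z : H z z = diag z by rewrite /H eqxx.
    have H1 z : H z z.+1 = G z z.+1 by rewrite -addn1 HD // /n; lia.
    have H2 z : H z z.+2 = G z z.+2 by rewrite -addn2 HD // /n; lia.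
    by rewrite Hxx diagE !H1 H2; ring.
  rewrite -!addnS !HDS ?HD /n; try lia.
  have e1 := exch x k; have e2 := exch x k.+1.
  rewrite -e1 in e2; try lia.
  have -> (a b c f : R) : a - b - c + f = (a - c) - (b - f) by ring.
  by rewrite e2 ?subrr //; lia.
have shiftH a : H (a + d).-1%N a - H (a + d).-1%N (a + d)%N =
               H (a + d).+1%N a - H (a + d).+1%N (a + d)%N.
  have -> : ((a + d).-1 = a + d.-1)%N by lia.
  have -> : ((a + d).+1 = a + d.+1)%N by lia.
  have e1 : H (a + d.-1)%N (a + d)%N = G (a + d.-1)%N (a + d)%N.
    have -> : (a + d = (a + d.-1) + 1)%N by lia.
    by rewrite HD // /n; lia.
  rewrite e1 addnS [H _ (a + d)%N]H_sym -[(a + d).+1]addn1 !HD -?addnA /n; try lia.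
  rewrite ![H _ a]H_sym !HD /n; try lia.
  have := shift a; have -> : ((a + d).-1 = a + d.-1)%N by lia.
  by rewrite !addn1 addnS ![G _ a]G_sym => ->; rewrite [G _ (a + d)%N]G_sym.
have [lam [p Hp]] := circular_decomp d_gt1 H_sym H_per zero shiftH C_sym C_per C_val.
by exists lam, p => x y xy; rewrite -Hp HG.
Qed.

End Core.

(** * Tight tours and exchanges *)

Section TightTours.
Variable d : nat.
Hypotheses (d_gt1 : (1 < d)%N) (d_even : ~~ odd d).
Let n := (d + d)%N.
Let d_gt0 : (0 < d)%N := ltnW d_gt1.
Notation relabel := (relabel d_gt0).
Notation C := (coincidence d).

Lemma uniq_relabel_iota a : uniq (map relabel (iota a n)).
Proof.
rewrite map_inj_in_uniq ?iota_uniq // => x y; rewrite !mem_iota => /andP[ax xn] /andP[ay yn].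
move/eqP; rewrite relabel_eqmod // -(subnKC ax) -(subnKC ay) eqn_modDl.
by rewrite !modn_small ?ltn_subLR // => /eqP->.
Qed.

Lemma C_val x y : (x <= y <= x + d)%N -> C x y = (d + x - y)%N.
Proof. by move=> h; rewrite -{1}(@subnKC x y) ?coincidence_val; lia. Qed.

Lemma C_val_wrap x y : (x + d <= y <= x + n)%N -> C x y = (y - x - d)%N.
Proof.
by move=> h; rewrite -(coincidenceDl d_gt0) coincidenceC C_val; rewrite /n in h *; lia.
Qed.

(** Vertices are listed by circular coordinates, as arbitrary natural numbers
    modulo n. *)
Definition tight (p : seq nat) : Prop :=
  [/\ uniq (map relabel p), size p = n & cycle_weight C p = (n - 2)%N].

(** The 2-opt moves that preserve the cost produce new tight tours. *)
Lemma tight_two_opt A B : tight (A ++ B) -> (0 < size A)%N -> (0 < size B)%N ->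
  (C (last 0 A) (last 0 B) + C (head 0 B) (head 0 A) =
   C (last 0 A) (head 0 B) + C (last 0 B) (head 0 A))%N ->
  tight (A ++ rev B).
Proof.
move=> [u sz cw] A0 B0 CC.
have pm : perm_eq (A ++ rev B) (A ++ B) by rewrite perm_cat2l perm_rev.
split; [by rewrite (perm_uniq (perm_map relabel pm))|by rewrite (perm_size pm)|].
have e : (n - 2 + (C (last 0 A) (last 0 B) + C (head 0 B) (head 0 A)) =
  cycle_weight C (A ++ rev B) + (C (last 0 A) (head 0 B) + C (last 0 B) (head 0 A)))%N.
  by rewrite -cw; exact: two_opt (coincidenceC d) A0 B0.
by move/eqP: e; rewrite CC eqn_add2r => /eqP <-.
Qed.

(** The tour a + d, a, a + 1 + d, a + 1, ... alternates between the two arcs of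
    one antipodal cut. It has steps of cost 0 and 1 in turn, and a last one of
    cost d - 1. *)
Fixpoint zigzag (a k : nat) : seq nat :=
  if k is k'.+1 then (a + d)%N :: a :: zigzag a.+1 k' else [::].

Lemma size_zigzag a k : size (zigzag a k) = (k + k)%N.
Proof. by elim: k a => //= k IH a; rewrite IH addnS. Qed.

Lemma zigzag_cat a k l : zigzag a (k + l) = zigzag a k ++ zigzag (a + k) l.
Proof. by elim: k a => [|k IH] a; rewrite ?addn0 //= IH addSnnS. Qed.

Lemma perm_zigzag a k : perm_eq (zigzag a k) (iota a k ++ iota (a + d) k).
Proof.
elim: k a => //= k IH a; apply/permP => P; have /permP/(_ P) := IH a.+1.
by rewrite /= !count_cat /= addSn => ->; lia.
Qed.

Lemma last_zigzag a k x : last x (zigzag a k.+1) = (a + k)%N.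
Proof. by elim: k a x => [|k IH] a x; rewrite ?addn0 //= -[RHS]addSnnS -(IH a.+1 x). Qed.

Lemma head_zigzag a k s x : head x (zigzag a k ++ (a + k + d)%N :: s) = (a + d)%N.
Proof. by case: k => //=; rewrite addn0. Qed.

Lemma walk_zigzag a k : walk_weight C a (zigzag a.+1 k) = k.
Proof.
elim: k a => [|k IH] a; first by rewrite walk_weight_nil.
have up : C a (a.+1 + d) = 1%N by rewrite C_val_wrap /n; lia.
have across : C (a.+1 + d) a.+1 = 0%N by rewrite coincidenceC C_val; lia.
by rewrite /= !walk_weight_cons IH up across.
Qed.

Lemma tight_zigzag a : tight (zigzag a d).
Proof.
split; last 1 first.
- have -> : zigzag a d = [:: (a + d)%N, a & zigzag a.+1 d.-1] by rewrite -{1}(prednK d_gt0).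
  have across : C (a + d) a = 0%N by rewrite coincidenceC C_val; lia.
  rewrite /= walk_weight_cons walk_weight_rcons walk_zigzag across.
  have -> : last a (zigzag a.+1 d.-1) = (a + d.-1)%N.
    have -> : d.-1 = d.-2.+1 by lia.
    by rewrite last_zigzag; lia.
  rewrite C_val; last by lia.
  by rewrite /n -[(_ + _)%R]/(_ + _)%N; lia.
- rewrite (perm_uniq (perm_map relabel (perm_zigzag a d))) -iotaD.
  exact: uniq_relabel_iota.
- exact: size_zigzag.
Qed.

Section Exchange.
Variables (R : realFieldType) (w : nat -> nat -> R) (c : R).
Hypotheses (wC : forall x y, w x y = w y x)
           (w_per : forall x y, w (x + (d + d))%N y = w x y)
           (w_tight : forall p, tight p -> cycle_weight w p = c).

(** A function constant on tight tours does not change under a 2-opt move between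
    two of them, so its values at the four exchanged edges satisfy a linear relation. *)
Lemma tight_exchange A B : tight (A ++ B) -> (0 < size A)%N -> (0 < size B)%N ->
  (C (last 0 A) (last 0 B) + C (head 0 B) (head 0 A) =
   C (last 0 A) (head 0 B) + C (last 0 B) (head 0 A))%N ->
  w (last 0 A)%N (last 0 B)%N + w (head 0 B)%N (head 0 A)%N =
  w (last 0 A)%N (head 0 B)%N + w (last 0 B)%N (head 0 A)%N.
Proof.
move=> tAB A0 B0 CC; have := two_opt 0%N wC A0 B0.
by rewrite !w_tight //; [move/addrI|exact: tight_two_opt].
Qed.

(** Reversing all but the first two vertices of the zigzag at a gives the zigzag at
    a + 1 run backwards. *)
Lemma shift_exchange a :
  w (a + d).-1%N a - w (a + d).-1%N (a + d)%N = w (a + d).+1%N a - w (a + d).+1%N (a + d)%N.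
Proof.
have e : zigzag a d = [:: (a + d)%N; a] ++ zigzag a.+1 d.-1 by rewrite -{1}(prednK d_gt0).
have l : last 0%N (zigzag a.+1 d.-1) = (a + d).-1.
  have -> : d.-1 = d.-2.+1 by lia.
  by rewrite last_zigzag; lia.
have h : head 0%N (zigzag a.+1 d.-1) = (a + d).+1.
  by have -> : d.-1 = d.-2.+1 by lia.
have := tight_zigzag a; rewrite e => /tight_exchange.
rewrite l h /= size_zigzag => H.
have {H} : w a (a + d).-1 + w (a + d).+1 (a + d)%N = w a (a + d).+1 + w (a + d).-1 (a + d)%N.
  apply: H => //; first by lia.
  rewrite (C_val_wrap (y := (a + d).+1)); last by rewrite /n; lia.
  rewrite [C _.+1 _]coincidenceC !C_val; lia.
rewrite [w a (a + d).-1]wC [w a (a + d).+1]wC => H.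
by apply/eqP; rewrite subr_eq addrAC -subr_eq opprK H addrC.
Qed.

(** Write b = a + q. A first 2-opt move reverses the end of the zigzag from b + 1 on;
    a second one reverses everything that comes after b + d. *)
Lemma cross_exchange a q : (q + 2 <= d)%N ->
  w (a + q + d)%N (a + q).+1 + w (a + q)%N (a + d)%N =
  w (a + q + d)%N (a + q)%N + w (a + q).+1 (a + d)%N.
Proof.
move=> qd; set b := (a + q)%N; set r := (d - q - 2)%N.
have e : zigzag a d = zigzag a q ++
    [:: (b + d)%N, b, (b.+1 + d)%N, b.+1 & zigzag b.+2 r].
  have dE : (d = q + r.+2)%N by lia.
  by rewrite {1}dE zigzag_cat.
have l : last b.+1 (zigzag b.+2 r) = (a + d).-1.
  case E : r => [|r']; last by rewrite last_zigzag; lia.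
  by rewrite /= /b; lia.
have h s : head 0%N (zigzag a q ++ (b + d)%N :: s) = (a + d)%N by exact: head_zigzag.
have t1 : tight ((zigzag a q ++ [:: (b + d)%N; b; (b.+1 + d)%N]) ++ b.+1 :: zigzag b.+2 r).
  by rewrite -catA -e; exact: tight_zigzag.
have {t1} := tight_two_opt t1; rewrite h last_cat /= l size_cat addnS /= => t2.
have {}t2 : tight ((zigzag a q ++ [:: (b + d)%N]) ++
     (b :: (b.+1 + d)%N :: rev (b.+1 :: zigzag b.+2 r))).
  rewrite -catA /=; rewrite -catA /= in t2; apply: t2 => //.
  by rewrite ![C (b.+1 + d) _]coincidenceC !C_val /b; lia.
have := tight_exchange t2; rewrite h last_cat /= rev_cons last_rcons size_cat /= addn1.
apply=> //.
by rewrite ![C (b + d) _]coincidenceC !C_val /b; lia.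
Qed.

Lemma tight_constant_decomp : exists (lam : R) (p : nat -> R),
  forall x y, x != y %[mod d + d] -> w x y = lam * (C x y)%:R + p x + p y.
Proof.
apply: (circular_decomp_offdiag (C := fun x y => (C x y)%:R) d_gt1 wC w_per _ shift_exchange).
- move=> x k kd; have qd : (d - k + 2 <= d)%N by lia.
  have := cross_exchange (x + n - (d - k)) qd.
  have -> : (x + n - (d - k) + (d - k) = x + n)%N by rewrite /n; lia.
  have -> : (x + n - (d - k) + d = x + k + n)%N by rewrite /n; lia.
  rewrite -addSn [(x + n + d)%N]addnAC !w_per !(wC _ (_ + n)%N) !w_per.
  by rewrite ![w (x + k)%N _]wC; lra.
- by move=> x y; rewrite coincidenceC.
- by move=> x y; rewrite coincidenceDl.
- by move=> x k kd; rewrite coincidence_val.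
Qed.
End Exchange.

(** * Functionals on tours *)

Section Tours.
Variable R : realType.
Notation side := (fun (a : 'I_d) (u : 'I_n) => arc_side d a (d.+1 * u)).

Lemma arc_side_relabel a x : arc_side d a (d.+1 * relabel x) = arc_side d a x.
Proof.
have per q y : arc_side d a (y + q * n) = arc_side d a y.
  by elim: q => [|q IH]; rewrite ?addn0 // mulSn addnCA addnC arc_sideD.
have mod y z : (y = z %[mod n])%N -> arc_side d a y = arc_side d a z.
  by move=> e; rewrite (divn_eq y n) addnC per e -(per (z %/ n)%N) addnC -divn_eq.
apply: mod; have /eqP := relabelK d_gt0 d_even (relabel x).
by rewrite relabel_eqmod // => /eqP.
Qed.

Lemma agreement_relabel x y : agreement side (relabel x) (relabel y) = C x y.
Proof. by apply: eq_bigr => a _; rewrite !arc_side_relabel. Qed.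

Lemma circlet_pair_agreement (u v : 'I_n) : u != v ->
  circlet (pair_vec R u v) = (agreement side u v)%:R.
Proof.
move=> uv; have half_n : n./2 = d by rewrite /n addnn doubleK.
rewrite circlet_pair // half_n -{1}(relabelK d_gt0 d_even u) -{1}(relabelK d_gt0 d_even v).
by rewrite coeff_relabel // -(relabel_eqmod d_gt0) // !relabelK.
Qed.

Lemma circlet_tour (s : seq 'I_n) : uniq s -> size s = n ->
  circlet (incidence R (tour_edges s)) = (cycle_weight (agreement side) s)%:R.
Proof.
move=> us sn; have n2 : (2 < n)%N by rewrite /n; lia.
rewrite linear_incidence ?sn //; last exact: mem_of_size.
rewrite !cycle_weight_next // natr_sum !big_seq; apply: eq_bigr => v vs.
by rewrite /= circlet_pair_agreement // eq_sym next_neq // sn; lia.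
Qed.

Lemma circlet_relabel_tour p : uniq (map relabel p) -> size p = n ->
  circlet (incidence R (tour_edges (map relabel p))) = (cycle_weight C p)%:R.
Proof.
move=> u sp; rewrite circlet_tour ?size_map // cycle_weight_map.
by congr (cycle_weight _ _)%:R; apply/funext => x; apply/funext => y; exact: agreement_relabel.
Qed.

Lemma circlet_ge (s : seq 'I_n) : uniq s -> size s = n ->
  n%:R - 2%:R <= circlet (incidence R (tour_edges s)).
Proof.
move=> us sn; rewrite circlet_tour // -natrB; last by rewrite /n; lia.
rewrite ler_nat; apply: agreement_cycle_ge => //; first by rewrite sn oddD addbb.
move=> a b ab; exists (relabel 0), (relabel (d - b)).
have abd : (a < b < d)%N by rewrite ab ltn_ord.
have [h0 h1] := arc_side_distinct d_gt0 abd.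
by split; rewrite ?arc_side_relabel //; exact: mem_of_size.
Qed.

Lemma relabel_tour p : uniq (map relabel p) -> size p = n ->
  hamiltonian_cycle (tour_edges (map relabel p)).
Proof. by move=> u sp; apply: hamiltonian_tour; rewrite ?size_map // /n; lia. Qed.

(** The tour in the order of the circular coordinates is not tight, so the cost is not
    constant. *)
Lemma cycle_weight_iota : cycle_weight C (iota 0 n) = (n * d.-1)%N.
Proof.
have walk a k : walk_weight C a (iota a.+1 k) = (k * d.-1)%N.
  elim: k a => [|k IH] a; first by rewrite walk_weight_nil.
  by rewrite /= walk_weight_cons IH C_val; [rewrite -[(_ + _)%R]/(_ + _)%N mulSn; lia|lia].
have -> : n = n.-1.+1 by rewrite /n; lia.
rewrite /= walk_weight_rcons walk -[(_ + _)%R]/(_ + _)%N.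
have -> : last 0%N (iota 1 n.-1) = n.-1.
  by rewrite -nth_last size_iota nth_iota; rewrite /n; lia.
have -> : C n.-1 0 = d.-1 by rewrite coincidenceC C_val_wrap; rewrite /n; lia.
by rewrite mulSn addnC.
Qed.

(** On a tour, the terms p x + p y of the decomposition of edge weights count each vertex
    twice, so they only contribute a constant. *)
Lemma circlet_functional_decomp (g : {scalar edge_space R n}) (c : R) :
  (forall H, @hamiltonian_cycle n H ->
     circlet (incidence R H) = n%:R - 2%:R -> g (incidence R H) = c) ->
  exists lam kap : R, forall H, @hamiltonian_cycle n H ->
     g (incidence R H) = lam * circlet (incidence R H) + kap.
Proof.
move=> gc; have n2 : (2 < n)%N by rewrite /n; lia.
pose w x y := g (pair_vec R (relabel x) (relabel y)).
have wC x y : w x y = w y x by rewrite /w pair_vecC.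
have w_per x y : w (x + (d + d))%N y = w x y.
  rewrite /w; congr (g (pair_vec _ _ _)); apply/eqP.
  by rewrite relabel_eqmod // modnDr.
have w_tight p : tight p -> cycle_weight w p = c.
  move=> [u sp cp]; rewrite -(gc _ (relabel_tour u sp)).
    rewrite linear_incidence ?size_map ?sp // ?cycle_weight_map //.
    by apply: mem_of_size; rewrite ?size_map.
  by rewrite circlet_relabel_tour // cp natrB // ltnW.
have [lam [p wE]] := tight_constant_decomp wC w_per w_tight.
exists lam, (2 * \sum_(v : 'I_n) p (d.+1 * v)%N) => H [s [s2 /andP[_ us] full ->]].
have sn : size s = n by exact: size_of_mem.
rewrite circlet_tour // linear_incidence // !cycle_weight_next //.
rewrite natr_sum mulr_sumr.
have -> : \sum_(v <- s) g (pair_vec R v (next s v)) =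
   \sum_(v <- s) (lam * (agreement side v (next s v))%:R +
     (p (d.+1 * v)%N + p (d.+1 * next s v)%N)).
  rewrite !big_seq; apply: eq_bigr => v vs.
  have := wE (d.+1 * v)%N (d.+1 * next s v)%N.
  rewrite /w -relabel_eqmod // !relabelK // -agreement_relabel !relabelK // => ->.
    by rewrite addrA.
  by rewrite eq_sym next_neq // sn; lia.
rewrite big_split; congr (_ + _).
have all F : \sum_(v <- s) F v = \sum_(v : 'I_n) F v :> R.
  by rewrite big_uniq //; apply: eq_bigl => v; rewrite full.
rewrite all big_split mulr2n mulrDl mul1r; congr (_ + _).
by rewrite [RHS](reindex_inj (can_inj (prev_next us))).
Qed.
End Tours.
End TightTours.

(** * The facet *)

Theorem theorem5p1 (R : realType) (n : nat) (hn : (0 < n)%N)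
  (h4 : (4 %| n)%N) :
  facet_defining (@STSP R n) (@circlet R n) (n%:R - 2%:R).
Proof.
have [d [d_gt1 d_even nE]] : exists d, [/\ (1 < d)%N, ~~ odd d & n = (d + d)%N].
  case/dvdnP: h4 hn => m -> hm; exists m.*2; rewrite odd_double -!muln2; split=> //; lia.
subst n; apply: facet_definingP.
- move=> _ [H [s [_ /andP[_ us] full ->]] <-]; apply: circlet_ge => //.
  exact: size_of_mem.
- have [u sp cp] := tight_zigzag d_gt1 d_even 0.
  eexists; split; first by apply: imageP; apply: relabel_tour u sp.
  by rewrite /= circlet_relabel_tour // cp natrB //; lia.
- have u := uniq_relabel_iota d_gt1 d_even 0.
  have sz : size (iota 0 (d + d)) = (d + d)%N by rewrite size_iota.
  eexists; split; first by apply: imageP; apply: relabel_tour u sz.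
  rewrite /= circlet_relabel_tour // cycle_weight_iota // -natrB; last by lia.
  by rewrite eqr_nat; nia.
- move=> g c gc; have [|lam [kap h]] := @circlet_functional_decomp d d_gt1 d_even R g c.
    by move=> H hH; apply: gc; exists H.
  by exists lam, kap => _ [H hH <-]; exact: h.
Qed.
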